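(* Let $S=(\mathcal A,H,\pi,D,J,\chi)$ be a real even spectral triple of KO-dimension $n$ mod $8$, with $\pi$ faithful. Let $\omega\in\Omega^1_D(\mathcal A,\pi)$ be an invertible noncommutative 1-form such that $\omega=\omega^*$, and let $$D_\omega=\frac{1-i}{2}D+\frac{1+i}{2}\omega D\omega^{-1},\quad(\cdot,\cdot)_\omega=\langle\cdot,\omega\,\cdot\rangle,\quad J_\omega=\omega J,\quad\chi_\omega=-\chi.$$ Then $S_\omega=(\mathcal A,H,(\cdot,\cdot)_\omega,\pi,D_\omega,J_\omega,\chi_\omega)$ is a (reconstructible) antilorentzian spectral spacetime of KO-dimension $2-n$ mod $8$ on which $\omega$ is a positive time-orientation 1-form if and only if $$J\omega J^{-1}=-\omega,\qquad\omega^2=1,\qquad\text{and}\qquad\omega\in\Omega^1_{D_\omega}(\mathcal A,\pi).$$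
   Context: Analytical questions (domains, boundedness, compactness of resolvents) are set aside; everything is algebraic. **Real even spectral triple** of KO-dimension $k$ mod 8 (algebraic part, no order-0 or order-1 condition assumed): $(\mathcal A,H,\pi,D,J,\chi)$ with $\mathcal A$ an involutive unital algebra, $(H,\langle\cdot,\cdot\rangle)$ a Hilbert space, $\pi$ a $*$-representation, $D=D^*$, $\chi=\chi^*$, $\chi^2=1$, $\chi$ commuting with $\pi(\mathcal A)$ and anticommuting with $D$, $J$ antiunitary with $J^2=\epsilon$, $JD=DJ$, $J\chi=\epsilon''\chi J$, where $(\epsilon,\epsilon'')=(1,1),(-1,-1),(-1,1),(1,-1)$ for $k=0,2,4,6$ respectively. **1-forms.** $\Omega^1_D(\mathcal A,\pi)=\{\sum_i\pi(a_i)[D,\pi(b_i)]\ (\text{finite sums}),\ a_i,b_i\in\mathcal A\}$, and similarly with $D_\omega$ in place of $D$. **Antilorentzian spectral spacetime** of KO-dimension $k$ mod 8: a multiplet $(\mathcal A,K,(\cdot,\cdot),\pi,D,J,\chi)$ where $(K,(\cdot,\cdot))$ is a Krein space with adjunction $\times$ ($(A^\times\phi,\psi)=(\phi,A\psi)$ for linear $A$, $(A^\times\phi,\psi)=\overline{(\phi,A\psi)}$ for antilinear $A$); $\mathcal A$ is a unital complex algebra, $\pi$ a representation of it on $K$; $D^\times=D$; $\chi^2=1$, $[\pi(a),\chi]=0$ for all $a\in\mathcal A$, $\chi D=-D\chi$, $\chi^\times=-\chi$; $J$ is antilinear with $J^2=\epsilon$, $JD=DJ$, $J\chi=\epsilon''\chi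 J$, $J^\times J=\kappa$, where $(\epsilon,\epsilon'',\kappa)=(1,1,-1),(-1,-1,-1),(-1,1,-1),(1,-1,-1)$ for $k=0,2,4,6$ respectively; and such that there exists a *positive time-orientation 1-form*, i.e. an element $\beta\in\Omega^1_D(\mathcal A,\pi)$ with $\beta^\times=\beta$, $J\beta J^{-1}=-\beta$ and $\langle\cdot,\cdot\rangle_\beta:=(\cdot,\beta^{-1}\cdot)$ positive definite. It is *reconstructible* if $\pi$ is faithful and some positive time-orientation 1-form $\beta$ satisfies $\pi(\mathcal A)^{*_\beta}=\pi(\mathcal A)$, where $A^{*_\beta}=\beta A^\times\beta^{-1}$. *)

(* Defs.v *)
From mathcomp Require Import all_boot all_order all_algebra.
From mathcomp Require Import all_classical all_reals.
From mathcomp Require Import complex.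

Set Implicit Arguments.
Unset Strict Implicit.
Unset Printing Implicit Defensive.

Import Order.TTheory GRing.Theory Num.Theory.

Local Open Scope classical_set_scope.
Local Open Scope ring_scope.

(* Operators are plain functions, added and scaled pointwise; linearity is
   required where it belongs.  No domain or boundedness condition is imposed,
   so adjoints are relations: an operator need not have one a priori. *)

Section Operators.
Variables (R : realType) (H : lmodType R[i]).
Implicit Types (form : H -> H -> R[i]) (A B : H -> H).

Definition antilinear A := linear_for (Num.conj \; *:%R) A.

(* Junk value unless A is bijective. *)
Definition op_inv A : H -> H := 'pinv_(fun=> 0) [set: H] A.

(* form is linear in its second argument, hence antilinear in the first. *)
Definition hermitian_form form :=
  (forall phi, scalar (form phi)) /\
  (forall phi psi, form phi psi = (form psi phi)^*).

Definition positive_definite form := forall phi, phi != 0 -> 0 < form phi phi.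

(* Sequential completeness for the norm phi |-> sqrt (form phi phi).  For
   e : R[i], 0 < e means that e is a positive real, and e stands for the square
   of the usual epsilon. *)
Definition complete_form form := forall u : nat -> H,
  (forall e : R[i], 0 < e -> exists N, forall m n, (N <= m)%N -> (N <= n)%N ->
     form (u m - u n) (u m - u n) < e) ->
  exists l, forall e : R[i], 0 < e -> exists N, forall n, (N <= n)%N ->
     form (u n - l) (u n - l) < e.

Definition hilbert_space form :=
  [/\ hermitian_form form, positive_definite form & complete_form form].

(* B is the adjoint of A, for A linear, resp. antilinear. *)
Definition adjoint form A B := forall phi psi, form (B phi) psi = form phi (A psi).
Definition anti_adjoint form A B :=
  forall phi psi, form (B phi) psi = (form phi (A psi))^*.

Definition fundamental_symmetry form (eta : H -> H) :=
  [/\ linear eta, eta \o eta = idfun, adjoint form eta eta &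
      hilbert_space (fun phi psi => form phi (eta psi))].

Definition krein_space form :=
  hermitian_form form /\ exists eta, fundamental_symmetry form eta.

Definition antiunitary form A :=
  [/\ antilinear A, (forall psi, exists phi, A phi = psi) &
      forall phi psi, form (A phi) (A psi) = (form phi psi)^*].

End Operators.

(* The signs epsilon and epsilon'', meaningful for even k only. *)
Definition KO_eps (k : int) : int :=
  if (k %% 8)%Z \in ([:: 0; 6] : seq int) then 1 else -1.
Definition KO_eps'' (k : int) : int :=
  if (k %% 8)%Z \in ([:: 0; 4] : seq int) then 1 else -1.

Section Spacetimes.
Variables (R : realType) (A : algType R[i]) (H : lmodType R[i]).
Implicit Types (form : H -> H -> R[i]) (pi : A -> H -> H) (D J chi beta : H -> H).

Definition involution (star : A -> A) :=
  [/\ involutive star, linear_for (Num.conj \; *:%R) star &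
      forall a b, star (a * b) = star b * star a].

Definition representation pi :=
  [/\ (forall a, linear (pi a)), linear pi, pi 1 = idfun &
      forall a b, pi (a * b) = pi a \o pi b].

Definition Omega1 pi D : set (H -> H) :=
  [set w | exists s : seq (A * A),
     w = \sum_(p <- s) (pi p.1 \o ((D \o pi p.2) - (pi p.2 \o D)))].

Record real_even_spectral_triple (k : int) (star : A -> A)
    form pi D J chi : Prop := {
  rst_even : (2 %| k)%Z;
  rst_star : involution star;
  rst_hilbert : hilbert_space form;
  rst_rep : representation pi;
  rst_repstar : forall a, adjoint form (pi a) (pi (star a));
  rst_Dlin : linear D;
  rst_Dadj : adjoint form D D;
  rst_chilin : linear chi;
  rst_chiadj : adjoint form chi chi;
  rst_chi2 : chi \o chi = idfun;
  rst_chipi : forall a, chi \o pi a = pi a \o chi;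
  rst_chiD : chi \o D = - (D \o chi);
  rst_J : antiunitary form J;
  rst_J2 : J \o J = (KO_eps k)%:~R *: idfun;
  rst_JD : J \o D = D \o J;
  rst_Jchi : J \o chi = (KO_eps'' k)%:~R *: (chi \o J) }.

Definition positive_time_orientation form pi D J beta :=
  [/\ Omega1 pi D beta, bijective beta, adjoint form beta beta,
      J \o beta \o op_inv J = - beta &
      positive_definite (fun phi psi => form phi (op_inv beta psi))].

(* kappa = -1 in every even KO-dimension. *)
Record antilorentzian_spacetime (k : int) form pi D J chi : Prop := {
  als_even : (2 %| k)%Z;
  als_krein : krein_space form;
  als_rep : representation pi;
  als_Dlin : linear D;
  als_Dadj : adjoint form D D;
  als_chilin : linear chi;
  als_chi2 : chi \o chi = idfun;
  als_chipi : forall a, pi a \o chi = chi \o pi a;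
  als_chiD : chi \o D = - (D \o chi);
  als_chiadj : adjoint form chi (- chi);
  als_Jlin : antilinear J;
  als_J2 : J \o J = (KO_eps k)%:~R *: idfun;
  als_JD : J \o D = D \o J;
  als_Jchi : J \o chi = (KO_eps'' k)%:~R *: (chi \o J);
  als_kappa : exists Jx, anti_adjoint form J Jx /\ Jx \o J = - idfun;
  als_pto : exists beta, positive_time_orientation form pi D J beta }.

(* Equality of the sets of operators pi(A)^{*_beta} and pi(A), every pi a being
   required to have an adjoint. *)
Definition star_stable form pi beta :=
  (forall a, exists B, adjoint form (pi a) B) /\
  [set beta \o B \o op_inv beta | B in
     [set B | exists a, adjoint form (pi a) B]] = range pi.

Definition reconstructible form pi D J :=
  injective pi /\
  exists beta,
    positive_time_orientation form pi D J beta /\ star_stable form pi beta.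

End Spacetimes.

(* Main.v *)
Require Import Defs.
From mathcomp Require Import all_boot all_order all_algebra.
From mathcomp Require Import all_classical all_reals.
From mathcomp Require Import complex.
From mathcomp Require Import zify.

Set Implicit Arguments.
Unset Strict Implicit.
Unset Printing Implicit Defensive.

Import Order.TTheory GRing.Theory Num.Theory.

Local Open Scope classical_set_scope.
Local Open Scope ring_scope.

(** Necessity comes from the real structure.  Conjugating [omega] by
    [omega \o J] or by [J] gives the same condition, since the outer [omega]
    cancels ([twisted_J_conjN]); so time-orientability forces [J] and [omega]
    to anticommute.  Then [(omega J)^2 = - omega^2 J^2], and going from
    KO-dimension [n] to [2 - n] reverses the sign of the square of the real
    structure ([KO_eps_sub2]); hence the value prescribed for [(omega J)^2]
    says exactly that [omega^2 = 1] ([omega_involutive]).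

    For sufficiency, an [omega] that is selfadjoint with [omega^2 = 1] is a
    fundamental symmetry of the twisted form, and applying it to both sides of
    a pairing recovers the original inner product.  With [c = (1 - i) / 2] the
    twisted Dirac operator is [c D + c^* omega D omega].  Conjugation by
    [omega] exchanges its two terms, and so do the antilinearity of
    [omega \o J] and the passage to the Hilbert adjoint, which replace [c] by
    [c^*]: the exchanges compensate, so the operator is Krein-selfadjoint
    ([wick_dirac_adjoint]) and commutes with [omega \o J]
    ([wick_dirac_comm]).  As a one-form, [omega] anticommutes with [chi]
    ([Omega1_anticomm]), which yields all the grading axioms, including the
    reversed sign [epsilon''].  For reconstructibility, the Krein adjoint of
    [pi a] is [omega \o pi (star a) \o omega], and conjugating it by [omega]
    returns [pi (star a)] ([twisted_star_stable]). *)

(** * Signs *)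

Lemma KO_eps_sub2 (k : int) : (2 %| k)%Z -> KO_eps (2 - k) = - KO_eps k.
Proof. by move=> k2; rewrite /KO_eps !inE; case: ifP; case: ifP; lia. Qed.

Lemma KO_eps''_sub2 (k : int) : (2 %| k)%Z -> KO_eps'' (2 - k) = - KO_eps'' k.
Proof. by move=> k2; rewrite /KO_eps'' !inE; case: ifP; case: ifP; lia. Qed.

Lemma sqr_KO_eps (K : pzRingType) (k : int) :
  (KO_eps k)%:~R * (KO_eps k)%:~R = 1 :> K.
Proof. by rewrite /KO_eps; case: ifP; rewrite ?mulrNN mulr1. Qed.

(** * Operators and forms *)

Section Operators.
Variables (R : realType) (H : lmodType R[i]).
Implicit Types (form : H -> H -> R[i]) (A B D J w chi : H -> H).

Lemma linear_opN A : linear A -> forall x, A (- x) = - A x.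
Proof.
move=> A_lin x.
by rewrite -scaleN1r (scalable_linear A_lin) /= scaleN1r.
Qed.

Lemma antilinear_opN A : antilinear A -> forall x, A (- x) = - A x.
Proof.
move=> A_lin x.
by rewrite -scaleN1r (scalable_linear A_lin) /= rmorphN1 scaleN1r.
Qed.

Lemma linear_opZD A : linear A ->
  forall a b x y, A (a *: x + b *: y) = a *: A x + b *: A y.
Proof. by move=> A_lin a b x y; rewrite A_lin (scalable_linear A_lin). Qed.

Lemma antilinear_opZD A : antilinear A ->
  forall a b x y, A (a *: x + b *: y) = a^* *: A x + b^* *: A y.
Proof. by move=> A_lin a b x y; rewrite A_lin (scalable_linear A_lin). Qed.

Lemma scalarZD (f : H -> R[i]) : scalar f ->
  forall a b x y, f (a *: x + b *: y) = a * f x + b * f y.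
Proof. by move=> f_lin a b x y; rewrite f_lin (scalable_linear f_lin). Qed.

Lemma op_inv_unique A B : cancel A B -> cancel B A -> op_inv A = B.
Proof.
move=> AK BK; apply/funext => y; rewrite -{1}(BK y) /op_inv pinvKV ?inE //.
by move=> u v _ _; apply: (can_inj AK).
Qed.

Lemma bijective_scaled_involution A (c : R[i]) :
  c * c = 1 -> A \o A = c *: idfun -> bijective A.
Proof.
move=> cc AA; have AAE x : A (A x) = c *: x by exact: (congr1 (@^~ x) AA).
have cK (x : H) : c *: (c *: x) = x by rewrite scalerA cc scale1r.
exists (fun x => A (c *: x)) => x; last by rewrite AAE cK.
by rewrite -AAE -[A (A (A x))]/(A _) !AAE cK.
Qed.

Lemma conj_opN J w : bijective J ->
  J \o w \o op_inv J = - w <-> forall x, J (w x) = - w (J x).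
Proof.
case=> J' JK J'K; rewrite (op_inv_unique JK J'K); split=> [E x|E].
  by rewrite -{1}(JK x); exact: (congr1 (@^~ (J x)) E).
by apply/funext => x /=; rewrite E J'K.
Qed.

Lemma form_inj form x y : hermitian_form form -> positive_definite form ->
  (forall u, form x u = form y u) -> x = y.
Proof.
move=> [lin herm] pos xy; apply/eqP; rewrite -subr_eq0; apply: contraT.
move=> /pos; rewrite (zmod_morphism_linear (lin _)) herm.
by rewrite [X in _ - X]herm xy subrr ltxx.
Qed.

(** The Wick rotation of [D] along an involution [w]: tying the second
    coefficient to the conjugate of the first is what makes conjugation by [w]
    act on this operator as conjugation of [c]. *)
Definition wick_dirac (c : R[i]) D w : H -> H := c *: D + c^* *: (w \o D \o w).

Section Twist.
Variables (form : H -> H -> R[i]) (D J w chi : H -> H) (c : R[i]).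
Hypotheses (form_herm : hermitian_form form) (D_lin : linear D)
  (w_lin : linear w) (w_adj : adjoint form w w) (w_invol : involutive w).

Lemma wick_dirac_linear : linear (wick_dirac c D w).
Proof.
move=> a x y; rewrite /wick_dirac !fctE w_lin !D_lin w_lin !scalerDr !scalerA.
by rewrite [c * a]mulrC [c^* * a]mulrC addrACA.
Qed.

(** [w] itself is a fundamental symmetry: twisting twice by the involution
    [w] gives back the Hilbert form. *)
Lemma twisted_form_krein :
  hilbert_space form -> krein_space (fun x y => form x (w y)).
Proof.
move=> hil; have [lin herm] := form_herm; split; first split.
- by move=> x a y z; rewrite w_lin lin.
- by move=> x y; rewrite -w_adj herm.
exists w; split=> //.
- by apply/funext => x; apply: w_invol.
by have -> : (fun x y => form x (w (w y))) = form
  by do 2!apply/funext => ?; rewrite w_invol.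
Qed.

(** The Hilbert adjoint conjugates the coefficients of the Wick rotation,
    conjugation by [w] swaps its terms, and the Krein adjoint does both. *)
Lemma wick_dirac_adjoint : adjoint form D D ->
  adjoint (fun x y => form x (w y)) (wick_dirac c D w) (wick_dirac c D w).
Proof.
move=> D_adj; have [lin herm] := form_herm; move=> x y.
have formZDl a b u v z :
    form (a *: u + b *: v) z = a^* * form u z + b^* * form v z.
  by rewrite herm (scalarZD (lin z)) rmorphD !rmorphM /= -!herm.
rewrite /wick_dirac !fctE formZDl (linear_opZD w_lin) (scalarZD (lin x)).
rewrite conjCK w_invol.
by rewrite !w_adj !D_adj !w_adj !w_invol addrC.
Qed.

(** Moving [J] across conjugates [c] and moving [w] across swaps [D] with
    [w \o D \o w]; the sign from [J w = - w J] occurs twice in the second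
    term. *)
Lemma wick_dirac_comm : antilinear J -> J \o D = D \o J ->
  (forall x, J (w x) = - w (J x)) ->
  (w \o J) \o wick_dirac c D w = wick_dirac c D w \o (w \o J).
Proof.
move=> J_lin JD Jw.
have JDE x : J (D x) = D (J x) by exact: (congr1 (@^~ x) JD).
apply/funext => x; rewrite /wick_dirac !fctE /=.
rewrite (antilinear_opZD J_lin) conjCK Jw !JDE Jw.
rewrite (linear_opN D_lin) (linear_opN w_lin) opprK (linear_opZD w_lin).
by rewrite !w_invol addrC.
Qed.

Lemma wick_dirac_anticomm : linear chi -> chi \o D = - (D \o chi) ->
  (forall x, chi (w x) = - w (chi x)) ->
  chi \o wick_dirac c D w = - (wick_dirac c D w \o chi).
Proof.
move=> chi_lin chiD chiw.
have chiDE x : chi (D x) = - D (chi x) by exact: (congr1 (@^~ x) chiD).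
apply/funext => x; rewrite /wick_dirac !fctE /=.
rewrite (linear_opZD chi_lin) /= chiw !chiDE chiw (linear_opN D_lin).
by rewrite opprK opprD !scalerN.
Qed.

Lemma twisted_adjoint A B : adjoint form A B ->
  adjoint (fun x y => form x (w y)) A (w \o B \o w).
Proof. by move=> AB x y /=; rewrite w_adj w_invol AB w_adj. Qed.

(** Uniqueness holds although the twisted form is indefinite: [w] is onto, so
    pairing against all [w y] still separates vectors. *)
Lemma twisted_adjoint_unique A B B' : positive_definite form ->
  adjoint (fun x y => form x (w y)) A B ->
  adjoint (fun x y => form x (w y)) A B' -> B = B'.
Proof.
move=> pos AB AB'; apply/funext => x; apply: (form_inj form_herm pos) => u.
by rewrite -(w_invol u) AB AB'.
Qed.

End Twist.

End Operators.

(** * One-forms *)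

Section OneForms.
Variables (R : realType) (A : algType R[i]) (H : lmodType R[i]).
Variables (pi : A -> H -> H) (D w : H -> H).
Hypotheses (pi_rep : representation pi) (w_form : Omega1 pi D w).

Lemma Omega1_linear : linear D -> linear w.
Proof.
move=> D_lin a x y; have [s ->] := w_form; have [pi_lin _ _ _] := pi_rep.
rewrite !fct_sumE scaler_sumr -big_split; apply: eq_bigr => p _ /=.
rewrite !fctE /= -pi_lin; congr (pi _ _).
by rewrite !(pi_lin, D_lin) scalerBr opprD addrACA.
Qed.

(** Each summand [pi a [D, pi b]] has exactly one factor [D], and [chi]
    commutes with the rest. *)
Lemma Omega1_anticomm chi : linear chi ->
  (forall a, chi \o pi a = pi a \o chi) -> chi \o D = - (D \o chi) ->
  forall x, chi (w x) = - w (chi x).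
Proof.
move=> chi_lin chi_pi chiD x; have [s ->] := w_form.
have [pi_lin _ _ _] := pi_rep.
have chi_piE a y : chi (pi a y) = pi a (chi y).
  exact: (congr1 (@^~ y) (chi_pi a)).
have chiDE y : chi (D y) = - D (chi y) by exact: (congr1 (@^~ y) chiD).
have chiD2 y z : chi (y + z) = chi y + chi z.
  by rewrite -[y]scale1r chi_lin !scale1r.
have chi0 : chi 0 = 0 by apply: (addrI (chi 0)); rewrite -chiD2 !addr0.
rewrite !fct_sumE (big_morph chi chiD2 chi0) -sumrN; apply: eq_bigr => p _.
rewrite /= !fctE /= chi_piE -(linear_opN (pi_lin p.1)); congr (pi _ _).
rewrite chiD2 chiDE (linear_opN chi_lin) !chi_piE chiDE.
by rewrite (linear_opN (pi_lin p.2)) opprD.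
Qed.

End OneForms.

(** * The twisted triple *)

Section Twisted.
Variables (R : realType) (A : algType R[i]) (H : lmodType R[i]).
Variables (n : int) (star : A -> A) (ip : H -> H -> R[i]) (pi : A -> H -> H).
Variables (D J chi omega : H -> H).
Hypotheses (hS : real_even_spectral_triple n star ip pi D J chi).
Hypotheses (omega_form : Omega1 pi D omega) (omega_adj : adjoint ip omega omega).

Let J_antilinear : antilinear J. Proof. by case: (rst_J hS). Qed.
Let ip_herm : hermitian_form ip. Proof. by case: (rst_hilbert hS). Qed.
Let omega_lin : linear omega.
Proof. exact: Omega1_linear (rst_rep hS) omega_form (rst_Dlin hS). Qed.

Lemma spectral_triple_J_bijective : bijective J.
Proof. exact: bijective_scaled_involution (sqr_KO_eps _ n) (rst_J2 hS). Qed.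

Local Notation form := (fun phi psi => ip phi (omega psi)).

(** The inverse of [omega \o J] ends with the inverse of [omega], so the
    leftmost [omega] can be cancelled from the anticommutation relation. *)
Lemma twisted_J_conjN : bijective omega ->
  (omega \o J) \o omega \o op_inv (omega \o J) = - omega <->
  J \o omega \o op_inv J = - omega.
Proof.
have J_bij := spectral_triple_J_bijective.
move=> omega_bij; rewrite !conj_opN //; last exact: bij_comp.
split=> E x /=; last by rewrite E linear_opN.
by apply: (bij_inj omega_bij); rewrite linear_opN // -E.
Qed.

(** The anticommutation sign is absorbed by [epsilon (2 - n) = - epsilon n]. *)
Lemma twisted_J2 : (forall x, J (omega x) = - omega (J x)) ->
  (omega \o J) \o (omega \o J) = (KO_eps (2 - n))%:~R *: (omega \o omega).
Proof.
move=> Jw; apply/funext => x; rewrite !fctE /= Jw linear_opN //.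
rewrite -[J (J x)]/((J \o J) x) (rst_J2 hS) fctE.
rewrite !(scalable_linear omega_lin) /= KO_eps_sub2 ?(rst_even hS) //.
by rewrite rmorphN scaleNr.
Qed.

Lemma omega_involutive : (forall x, J (omega x) = - omega (J x)) ->
  (omega \o J) \o (omega \o J) = (KO_eps (2 - n))%:~R *: idfun ->
  omega \o omega = idfun.
Proof.
move=> Jw; rewrite twisted_J2 // => /(congr1 ( *:%R (KO_eps (2 - n))%:~R)).
by rewrite !scalerA sqr_KO_eps !scale1r.
Qed.

Section Involutive.
Hypotheses (Jw : forall x, J (omega x) = - omega (J x)).
Hypotheses (omega2 : omega \o omega = idfun).

Let omegaK : involutive omega.
Proof. by move=> x; exact: (congr1 (@^~ x) omega2). Qed.

Let omegaV : op_inv omega = omega. Proof. exact: op_inv_unique. Qed.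

Variable c : R[i].
Hypothesis omega_form_c : Omega1 pi (wick_dirac c D omega) omega.

(** The two occurrences of [omega] cancel in the form attached to the
    orientation, which is therefore the Hilbert inner product. *)
Lemma twisted_time_orientation :
  positive_time_orientation form pi (wick_dirac c D omega) (omega \o J) omega.
Proof.
have omega_bij : bijective omega by exists omega.
split=> //.
- apply/twisted_J_conjN => //.
  by apply/(conj_opN _ spectral_triple_J_bijective).
- have [_ pos _] := rst_hilbert hS.
  by move=> x x0; rewrite omegaV omegaK; exact: pos.
Qed.

Lemma twisted_spacetime :
  antilorentzian_spacetime (2 - n) form pi (wick_dirac c D omega)
    (omega \o J) (- chi).
Proof.
have omega_chi := Omega1_anticomm (rst_rep hS) omega_form (rst_chilin hS)
  (rst_chipi hS) (rst_chiD hS).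
have Jc x : J (chi x) = (KO_eps'' n)%:~R *: chi (J x).
  exact: (congr1 (@^~ x) (rst_Jchi hS)).
have chi_pi a x : chi (pi a x) = pi a (chi x).
  exact: (congr1 (@^~ x) (rst_chipi hS a)).
have [pi_lin _ _ _] := rst_rep hS.
have wJ2 : (omega \o J) \o (omega \o J) = (KO_eps (2 - n))%:~R *: idfun.
  by rewrite twisted_J2 // omega2.
have D_lin := rst_Dlin hS; have chi_lin := rst_chilin hS.
have [_ _ J_iso] := rst_J hS.
split.
- by rewrite rpredB // (rst_even hS).
- exact: twisted_form_krein (rst_hilbert hS).
- exact: rst_rep hS.
- exact: wick_dirac_linear (rst_Dlin hS) omega_lin.
- exact: wick_dirac_adjoint (rst_Dadj hS).
- by move=> a x y; rewrite !fctE (rst_chilin hS) opprD scalerN.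
- apply/funext => x; rewrite !fctE (linear_opN (rst_chilin hS)) opprK.
  exact: (congr1 (@^~ x) (rst_chi2 hS)).
- by move=> a; apply/funext => x; rewrite !fctE linear_opN // chi_pi.
- have E : chi \o wick_dirac c D omega = - (wick_dirac c D omega \o chi).
    by apply: wick_dirac_anticomm => //; exact: rst_chiD hS.
  have wD_lin := wick_dirac_linear c D_lin omega_lin.
  apply/funext => x; have := congr1 (@^~ x) E; rewrite !fctE /= => ->.
  by rewrite (linear_opN wD_lin).
- move=> x y; rewrite opprK !fctE (linear_opN omega_lin) -omega_chi.
  by rewrite (rst_chiadj hS).
- by move=> a x y; rewrite !fctE J_antilinear omega_lin.
- exact: wJ2.
- by apply: wick_dirac_comm => //; exact: rst_JD hS.
- apply/funext => x; rewrite !fctE /= KO_eps''_sub2 ?(rst_even hS) //.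
  rewrite (antilinear_opN J_antilinear) Jc (linear_opN omega_lin).
  rewrite (scalable_linear omega_lin) /= omega_chi opprK.
  by rewrite rmorphN scaleNr.
- have eC : ((KO_eps n)%:~R : R[i])^* = (KO_eps n)%:~R by rewrite rmorph_int.
  have [lin herm] := ip_herm.
  have ipZl a u v : ip (a *: u) v = a^* * ip u v.
    by rewrite herm (scalable_linear (lin v)) rmorphM /= -herm.
  have J2 x : J (J x) = (KO_eps n)%:~R *: x.
    exact: (congr1 (@^~ x) (rst_J2 hS)).
  (* [kappa = -1] makes the Krein adjoint of [omega J] minus its inverse, and
     that inverse is [epsilon (2 - n) omega J = - epsilon n omega J]. *)
  exists ((KO_eps n)%:~R *: (omega \o J)); split.
    move=> x y; rewrite !fctE /= ipZl omega_adj !omegaK.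
    rewrite -[ip (J x) y]conjCK -J_iso J2 ipZl eC rmorphM /= eC.
    by rewrite mulrA sqr_KO_eps mul1r.
  apply/funext => x; have := congr1 (@^~ x) wJ2; rewrite !fctE /= => ->.
  rewrite KO_eps_sub2 ?(rst_even hS) // rmorphN scaleNr scalerN scalerA.
  by rewrite sqr_KO_eps scale1r.
- by exists omega; exact: twisted_time_orientation.
Qed.

Lemma twisted_star_stable : star_stable form pi omega.
Proof.
have [starK _ _] := rst_star hS.
have [herm pos _] := rst_hilbert hS.
have adj a : adjoint form (pi a) (omega \o pi (star a) \o omega).
  exact: twisted_adjoint (rst_repstar hS a).
have conjK B : omega \o (omega \o B \o omega) \o omega = B.
  by apply/funext => x; rewrite /= !omegaK.
split=> [a|]; first by exists (omega \o pi (star a) \o omega).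
rewrite omegaV; apply/seteqP; split=> [_ [B [a aB] <-]|_ [a _ <-]].
  rewrite (twisted_adjoint_unique herm omegaK pos aB (adj a)) conjK.
  by exists (star a).
exists (omega \o pi a \o omega); last exact: conjK.
by exists (star a); rewrite -{2}[a]starK.
Qed.

End Involutive.
End Twisted.

Theorem proposition4 (R : realType) (A : algType R[i]) (H : lmodType R[i])
    (n : int) (star : A -> A) (ip : H -> H -> R[i]) (pi : A -> H -> H)
    (D J chi omega : H -> H)
    (hS : real_even_spectral_triple n star ip pi D J chi)
    (pi_faithful : injective pi)
    (omega_form : Omega1 pi D omega)
    (omega_bij : bijective omega)
    (omega_adj : adjoint ip omega omega) :
  let D_omega := (1 - 'i) / 2 *: D
                 + (1 + 'i) / 2 *: (omega \o D \o op_inv omega) in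
  let form_omega := fun phi psi => ip phi (omega psi) in
  let J_omega := omega \o J in
  let chi_omega := - chi in
  let conditions := [/\ J \o omega \o op_inv J = - omega,
                        omega \o omega = idfun &
                        Omega1 pi D_omega omega] in
  (antilorentzian_spacetime (2 - n) form_omega pi D_omega J_omega chi_omega /\
   positive_time_orientation form_omega pi D_omega J_omega omega
   <-> conditions) /\
  ([/\ antilorentzian_spacetime (2 - n) form_omega pi D_omega J_omega chi_omega,
       reconstructible form_omega pi D_omega J_omega &
       positive_time_orientation form_omega pi D_omega J_omega omega]
   <-> conditions).
Proof.
move=> D_omega form_omega J_omega chi_omega conditions.
have Jconj := conj_opN omega (spectral_triple_J_bijective hS).
have nec : antilorentzian_spacetime (2 - n) form_omega pi D_omega J_omega
      chi_omega ->
    positive_time_orientation form_omega pi D_omega J_omega omega -> conditions.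
  move=> als [omega_form' _ _ Jw _].
  have Jw' := (twisted_J_conjN hS omega_form omega_bij).1 Jw.
  split=> //; apply: (omega_involutive hS omega_form (Jconj.1 Jw')).
  exact: als_J2 als.
have suf : conditions ->
    [/\ antilorentzian_spacetime (2 - n) form_omega pi D_omega J_omega chi_omega,
      reconstructible form_omega pi D_omega J_omega &
      positive_time_orientation form_omega pi D_omega J_omega omega].
  move=> [/Jconj Jw omega2 omega_form'].
  have omegaK : involutive omega by move=> x; exact: (congr1 (@^~ x) omega2).
  have D_wick : D_omega = wick_dirac ((1 - 'i) / 2) D omega.
    rewrite /D_omega /wick_dirac (op_inv_unique omegaK omegaK).
    by rewrite rmorphM rmorphB /= conjCi fmorphV rmorph_nat rmorph1 opprK.
  rewrite D_wick in omega_form' *.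
  have pto :=
    twisted_time_orientation hS omega_form omega_adj Jw omega2 omega_form'.
  split=> //; first exact: (twisted_spacetime hS).
  by split=> //; exists omega; split=> //; exact: (twisted_star_stable hS).
split; split.
- by case; exact: nec.
- by case/suf.
- by case=> als _; exact: nec.
- exact: suf.
Qed.
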